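(* Let $\{f_\lambda\}_{\lambda>0}$ be a linear-smoother teacher family with pure-distilled refits $f_{\mathrm{pd},\lambda}$ and self-distilled predictors $f_{\mathrm{sd},\lambda,\xi}$ as defined in the context. Assume that $f_\lambda(x)-f_{\mathrm{pd},\lambda}(x)=-\lambda\,\partial_\lambda f_\lambda(x)$ for all $x$ (and all $\lambda>0$) and that $\lambda\mapsto R(\lambda)$ is differentiable. Fix $\lambda>0$ and assume $D(\lambda)>0$. Then the optimal mixing weight $\xi^\star(\lambda)\in\arg\min_{\xi\in\mathbb R}R(f_{\mathrm{sd},\lambda,\xi})$ and the optimal risk $R^\star_{\mathrm{sd}}(\lambda)=\min_{\xi\in\mathbb R}R(f_{\mathrm{sd},\lambda,\xi})$ satisfy $$\xi^\star(\lambda)=-\frac\lambda2\,\frac{R'(\lambda)}{D(\lambda)},\qquad R^\star_{\mathrm{sd}}(\lambda)=R(\lambda)-\frac{\lambda^2}{4}\,\frac{(R'(\lambda))^2}{D(\lambda)}.$$ In particular, if $R'(\lambda)\ne0$, then $R^\star_{\mathrm{sd}}(\lambda)<R(\lambda)$ and $\operatorname{sign}(\xi^\star(\lambda))=-\operatorname{sign}(R'(\lambda))$.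
   Context: Fix training inputs $X=(x_1,\dots,x_n)$ and labels $y\in\mathbb R^n$; $\mathcal D=(X,y)$; everything is conditional on $\mathcal D$. The teacher family is a linear smoother: for each $\lambda>0$ there is a vector-valued map $x\mapsto s_\lambda(x)\in\mathbb R^n$, depending on $X,\lambda$ but not on $y$, with $f_\lambda(x)=s_\lambda(x)^\top y$ and $\hat y_\lambda:=f_\lambda(X)=(f_\lambda(x_1),\dots,f_\lambda(x_n))^\top=S_\lambda y$ for a matrix $S_\lambda\in\mathbb R^{n\times n}$ depending on $X,\lambda$ but not on $y$. The pure-distilled refit is $f_{\mathrm{pd},\lambda}(x)=s_\lambda(x)^\top\hat y_\lambda$. For $\xi\in\mathbb R$ the self-distilled predictor applies the smoother to the mixed labels: $f_{\mathrm{sd},\lambda,\xi}(x)=s_\lambda(x)^\top((1-\xi)y+\xi\hat y_\lambda)=(1-\xi)f_\lambda(x)+\xi f_{\mathrm{pd},\lambda}(x)$. Let $(x_0,y_0)$ be a test pair (any distribution, possibly out-of-distribution) for which $y_0$, $f_\lambda(x_0)$, $f_{\mathrm{pd},\lambda}(x_0)$ have finite conditional second moments given $\mathcal D$. For a predictor $f$, $R(f)=\mathbb E[(y_0-f(x_0))^2\mid\mathcal D]$; $R(\lambda)=R(f_\lambda)$; $D(\lambda)=\mathbb E[(f_\lambda(x_0)-f_{\mathrm{pd},\lambda}(x_0))^2\mid\mathcal D]$.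
   Formalization: The identity f_λ − f_pd,λ = −λ ∂_λ f_λ is assumed for every label vector in ℝⁿ (as a property of the smoother), not only for the fixed y; for a single y the claim can fail, since the derivative of R need not pass under the expectation. *)

(* Defs.v *)
From HB Require Import structures.
From mathcomp Require Import all_boot all_order all_algebra.
From mathcomp Require Import all_classical all_reals all_analysis.

Set Implicit Arguments.
Unset Strict Implicit.
Unset Printing Implicit Defensive.

Import Order.TTheory GRing.Theory Num.Theory.
Import numFieldNormedType.Exports.

Local Open Scope classical_set_scope.
Local Open Scope ring_scope.

Section LinearSmoother.
Context {R : realType} {T : Type} {n : nat}.

(* [s lam x] is the weight vector s_lambda(x) attached to the (fixed) training
   inputs; only its values at [lam > 0] matter. *)
Implicit Types (s : R -> T -> 'cV[R]_n) (X : 'I_n -> T) (y : 'cV[R]_n).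

Definition teacher s y (lam : R) (x : T) : R := ((s lam x)^T *m y) 0 0.

Definition smoother_mx s X (lam : R) : 'M[R]_n :=
  \matrix_(i, j) s lam (X i) j 0.

Definition fitted s X y (lam : R) : 'cV[R]_n :=
  \col_i teacher s y lam (X i).

Lemma fittedE s X y lam : fitted s X y lam = smoother_mx s X lam *m y.
Proof.
by apply/colP => i; rewrite mxE /teacher [LHS]mxE [RHS]mxE; apply: eq_bigr => j _; rewrite !mxE.
Qed.

Definition pure_distilled s X y (lam : R) : T -> R :=
  teacher s (fitted s X y lam) lam.

Definition self_distilled s X y (lam xi : R) : T -> R :=
  teacher s ((1 - xi) *: y + xi *: fitted s X y lam) lam.

Lemma self_distilledE s X y lam xi x :
  self_distilled s X y lam xi x =
  (1 - xi) * teacher s y lam x + xi * pure_distilled s X y lam x.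
Proof.
by rewrite /self_distilled /pure_distilled /teacher mulmxDr -!scalemxAr !mxE.
Qed.

(* The identity f_lambda - f_pd,lambda = - lambda d/dlambda f_lambda is a
   property of the smoother, i.e. of the maps s_lambda and the training inputs,
   and is therefore required for every label vector.  If it is imposed for a
   single label vector only, f_lambda(x) can be an arbitrary differentiable
   function of lambda at each x outside the training inputs, and the derivative
   of the risk need not be computable under the expectation. *)
Definition distillation_identity s X : Prop :=
  forall (y : 'cV[R]_n) (x : T) (lam : R), 0 < lam ->
    derivable (fun l : R => teacher s y l x) lam 1 /\
    teacher s y lam x - pure_distilled s X y lam x
      = - lam * derive1 (fun l : R => teacher s y l x) lam.

End LinearSmoother.

Section Risk.
Context {d : measure_display} {Om : measurableType d} {R : realType}
  {T : Type}.

(* [P] is the conditional law given the training data.  [fine] sends an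
   infinite expectation to 0, so these are meaningful for square-integrable
   arguments only. *)
Definition risk (P : probability Om R) (x0 : Om -> T) (y0 : Om -> R)
    (f : T -> R) : R :=
  fine 'E_P[fun w => (y0 w - f (x0 w)) ^+ 2].

Definition sq_discrepancy (P : probability Om R) (x0 : Om -> T)
    (f g : T -> R) : R :=
  fine 'E_P[fun w => (f (x0 w) - g (x0 w)) ^+ 2].

End Risk.

Definition argmin {R : realType} (g : R -> R) : set R :=
  [set xi | forall xi', g xi <= g xi'].

(* Main.v *)
Require Import Defs.
From HB Require Import structures.
From mathcomp Require Import all_boot all_order all_algebra.
From mathcomp Require Import all_classical all_reals all_analysis.
From mathcomp Require Import ring lra.

Set Implicit Arguments.
Unset Strict Implicit.
Unset Printing Implicit Defensive.

Import Order.TTheory GRing.Theory Num.Theory.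
Import numFieldNormedType.Exports.

Local Open Scope classical_set_scope.
Local Open Scope ring_scope.

(** Write [f] for the teacher at [lam], [p] for its distilled refit, [u := f - p]
    and [e := y0 - f].  Since the self-distilled residual is [e + xi * u], its
    risk is the quadratic polynomial [E e^2 + 2 * xi * E (e u) + xi^2 * E u^2] in
    [xi], minimal at [- E (e u) / E u^2].  The distillation identity says that
    [u] is [- lam] times the derivative of the teacher; if the risk may be
    differentiated under the expectation, then [E (e u) = lam / 2 * R'] and the
    formulas follow.

    The differentiation under the expectation is the real issue, as no
    domination is assumed.  It holds because the identity makes the teachers
    near [lam] span a finite-dimensional space of functions.  Applied to the
    basis label vectors, the identity is a linear differential equation in [lam]
    for the weights [s lam x], with the same coefficients for all [x]
    ([smoother_ode]); by local uniqueness, linear relations between the vectors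
    [s lam x] persist when [lam] moves ([smoother_relation]).  So
    [(t, x) |-> teacher s y t x] has rank at most [n] for [t] near [lam], and is
    of the form [\sum_q c q t * teacher s y (mu q) x] with the [c q] combinations
    of functions [t |-> teacher s y t x'] ([teacher_skeleton]).  The [c q] are
    therefore differentiable, and the teachers at [mu q] square integrable, so
    near [lam] the risk is a quadratic polynomial in the [c q t]
    ([is_derive_risk]). *)

(** * Skeleton decomposition of finite-rank kernels *)

Lemma schur_complement_eq0 (K : fieldType) n (d : 'M[K]_1) (c : 'rV[K]_n)
    (b : 'cV[K]_n) (M : 'M[K]_n) :
  M \in unitmx -> block_mx d c b M \notin unitmx -> d = c *m invmx M *m b.
Proof.
move=> Mu; have -> : block_mx d c b M =
    block_mx 1%:M (c *m invmx M) 0 1%:M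
      *m block_mx (d - c *m invmx M *m b) 0 b M.
  by rewrite mulmx_block !mul1mx !mul0mx !add0r mulmxKV// subrK.
rewrite unitmxE det_mulmx det_ublock det_lblock !det1 !mul1r unitrM negb_and.
rewrite -(unitmxE M) Mu orbF det_mx11 unitfE negbK => /eqP dE.
by apply/eqP; rewrite -subr_eq0 [_ - _]mx11_scalar dE raddf0.
Qed.

(** A two-variable function all of whose [n]-minors vanish has finite rank, and
    is then a combination of its own sections: take a nonzero minor of maximal
    size and write that its bordered minors vanish.  Using sections of [F]
    itself, rather than abstract factors, is what makes the factors inherit the
    regularity of [F]: differentiability in [i], integrability in [j]. *)
Lemma skeleton_decomposition (K : fieldType) (I J : Type) (U : I -> Prop)
    (F : I -> J -> K) n :
  (forall (f : 'I_n -> I) (g : 'I_n -> J), (forall p, U (f p)) ->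
     \matrix_(p, q) F (f p) (g q) \notin unitmx) ->
  exists r (f : 'I_r -> I) (g : 'I_r -> J) (A : 'M[K]_r),
    (forall p, U (f p)) /\
    (forall i j, U i ->
       F i j = \sum_q (\sum_p F i (g p) * A p q) * F (f q) j).
Proof.
pose unit_minor r (f : 'I_r -> I) (g : 'I_r -> J) :=
  (forall p, U (f p)) /\ \matrix_(p, q) F (f p) (g q) \in unitmx.
elim: n => [|n IHn] sing.
  have void A : 'I_0 -> A by case.
  have /negP[] := sing (void I) (void J) (fun p => void _ p).
  by rewrite unitmxE det_mx00 unitr1.
have [[f [g [Uf fgu]]]|nounit] :=
    pselect (exists (f : 'I_n -> I) (g : 'I_n -> J), unit_minor n f g).
  exists n, f, g, (invmx (\matrix_(p, q) F (f p) (g q))); split=> // i j Ui.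
  (* The maximal minor, bordered by the row of [i] and the column of [j]. *)
  pose f' (k : 'I_(1 + n)) := if fintype.split k is inr p then f p else i.
  pose g' (k : 'I_(1 + n)) := if fintype.split k is inr p then g p else j.
  have Uf' p : U (f' p) by rewrite /f'; case: (fintype.split p).
  have := sing f' g' Uf'.
  have -> : \matrix_(p, q) F (f' p) (g' q) =
    block_mx (F i j)%:M (\row_p F i (g p)) (\col_q F (f q) j)
      (\matrix_(p, q) F (f p) (g q)).
    apply/matrixP => p q; rewrite !mxE /f' /g'.
    case: (fintype.split p) => a; rewrite mxE; case: (fintype.split q) => b; rewrite !mxE//.
    by rewrite !ord1 eqxx.
  move=> /(schur_complement_eq0 fgu)/matrixP/(_ 0 0).
  rewrite mxE eqxx mulr1n => ->; rewrite mxE; apply: eq_bigr => q _.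
  by rewrite !mxE; congr (_ * _); apply: eq_bigr => p _; rewrite !mxE.
by apply: IHn => f g Uf; apply/negP => u; apply: nounit; exists f, g.
Qed.

(** * Uniqueness for linear differential equations *)

Lemma is_derive_sumE (R : realType) r (F : 'I_r -> R -> R) (dF : 'I_r -> R) (a : R) :
  (forall q, is_derive a 1 (F q) (dF q)) ->
  is_derive a 1 (fun t => \sum_q F q t) (\sum_q dF q).
Proof.
move=> FdF; have -> : (fun t => \sum_q F q t) = \sum_q F q.
  by rewrite fct_sumE.
exact: is_derive_sum.
Qed.

Lemma mean_value_le (R : realType) (f df : R -> R) (a e C : R) :
  (forall t, `|t - a| <= e -> is_derive t 1 f (df t)) ->
  (forall t, `|t - a| <= e -> `|df t| <= C) ->
  forall t, `|t - a| <= e -> `|f t - f a| <= C * `|t - a|.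
Proof.
move=> fdf dfC.
have main b c : b <= c ->
    (forall t, t \in `[b, c]%R -> `|t - a| <= e) -> `|f c - f b| <= C * `|c - b|.
  move=> bc near_a.
  have drv t : t \in `[b, c]%R -> is_derive t 1 f (df t).
    by move=> /near_a; exact: fdf.
  have drvo t : t \in `]b, c[%R -> is_derive t 1 f (df t).
    by move=> /subset_itv_oo_cc; exact: drv.
  have cf : {within `[b, c], continuous f}.
    by apply: derivable_within_continuous => t /drv[].
  have [x tx ->] := MVT_segment bc drvo cf.
  by rewrite normrM ler_wpM2r// dfC// near_a.
move=> t te; have [ta|at_] := leP t a.
- rewrite distrC (distrC t); apply: main => // x; rewrite in_itv/= => /andP[tx xa].
  by move: te; rewrite !ler_norml; lra.
- apply: main; first exact: ltW.
  move=> x; rewrite in_itv/= => /andP[tx xa].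
  by move: te; rewrite !ler_norml; lra.
Qed.

(** Uniqueness on an explicit interval: if [m] is the maximum of
    [\sum_k `|z k t|], the mean value theorem gives [m <= n * e * C * m].  The
    half-width [e] depends on the bound [C] of the coefficients only, not on the
    solution, hence the same interval serves for a whole family of solutions. *)
Lemma linear_ode_unique (R : realType) n (z : 'I_n -> R -> R)
    (B : R -> 'M[R]_n) (a e C : R) :
  (forall t, `|t - a| <= e ->
     forall j, is_derive t 1 (z j) (\sum_k z k t * B t k j)) ->
  (forall t, `|t - a| <= e -> forall k j, `|B t k j| <= C) ->
  e * C *+ n < 1 -> (forall j, z j a = 0) ->
  forall t, `|t - a| <= e -> forall j, z j t = 0.
Proof.
move=> zB BC small za t te.
have e0 : 0 <= e := le_trans (normr_ge0 _) te.
pose u x := \sum_k `|z k x|.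
have ae : a - e <= a + e by lra.
have inE x : (x \in `[a - e, a + e]%R) = (`|x - a| <= e).
  by rewrite in_itv/= ler_norml; apply/idP/idP; lra.
have [|c] := @EVT_max R u _ _ ae.
  apply: continuous_in_subspaceT => x; rewrite mem_setE inE => xe.
  apply: cvg_big => [|k _]; [exact: add_continuous|]; apply: cvg_norm.
  apply: differentiable_continuous; rewrite -derivable1_diffP.
  by have [] := zB _ xe k.
rewrite inE => ce max_c.
have uj x j : `|z j x| <= u x.
  by rewrite /u (bigD1 j)//= lerDl sumr_ge0.
have u0 x : 0 <= u x by apply: sumr_ge0.
have zc j : `|z j c| <= e * C * u c.
  have C0 : 0 <= C by apply: le_trans (BC c ce j j).
  have := @mean_value_le R (z j) _ a e (u c * C) (fun x xe => zB x xe j).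
  rewrite za => /(_ _ c ce); rewrite subr0 => h.
  apply: (le_trans (h _)) => [x xe|].
    apply: (le_trans (ler_norm_sum _ _ _)).
    apply: (@le_trans _ _ (u x * C)).
      by rewrite /u mulr_suml ler_sum// => k _; rewrite normrM ler_wpM2l// BC.
    by rewrite ler_wpM2r// max_c// inE.
  by rewrite -[leLHS]mulrA [leLHS]mulrC ler_wpM2r// mulrC ler_wpM2r.
have uc : u c <= e * C *+ n * u c.
  apply: (@le_trans _ _ (\sum_(k < n) e * C * u c)).
    by apply: ler_sum => k _; exact: zc.
  by rewrite sumr_const card_ord mulrnAl.
have uc0 : u c = 0.
  apply/eqP; rewrite eq_le u0 andbT leNgt; apply/negP => uc_gt0.
  by move: uc; rewrite -[leLHS]mul1r ler_pM2r// leNgt small.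
move=> j; apply/eqP; rewrite -normr_le0 -uc0 (le_trans (uj _ _))//.
by rewrite max_c// inE.
Qed.

(** * The distillation identity as a differential equation *)

(** The distillation identity at the basis label vectors is a linear equation
    for the weights, whose matrix does not depend on the evaluation point. *)
Lemma smoother_ode (R : realType) (T : Type) n (s : R -> T -> 'cV[R]_n)
    (X : 'I_n -> T) :
  distillation_identity s X -> forall (l : R) (x : T) (j : 'I_n), 0 < l ->
  is_derive l 1 (fun t => s t x j 0)
    (\sum_k s l x k 0 * (l^-1 *: (smoother_mx s X l - 1%:M)) k j).
Proof.
move=> identity l x j l0.
pose ej : 'cV[R]_n := delta_mx j 0.
have teacherE t : teacher s ej t x = s t x j 0.
  by rewrite /teacher -colE !mxE.
have := identity ej x l l0.
have -> : teacher s ej ^~ x = fun t => s t x j 0 by exact/funext/teacherE.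
case=> drv dE; apply: DeriveDef; first exact: drv.
rewrite -derive1E; apply: (mulfI (lt0r_neq0 l0)).
apply: oppr_inj; rewrite -mulNr -dE teacherE /pure_distilled fittedE.
rewrite /teacher -colE.
have -> : \sum_k s l x k 0 * (l^-1 *: (smoother_mx s X l - 1%:M)) k j =
    ((s l x)^T *m (l^-1 *: (smoother_mx s X l - 1%:M))) 0 j.
  by rewrite [RHS]mxE; apply: eq_bigr => k _; rewrite [(s l x)^T 0 k]mxE.
have scaleE a (u : 'rV[R]_n) : (a *: u) 0 j = a * u 0 j by rewrite mxE.
have subE (u v : 'rV[R]_n) : (u - v) 0 j = u 0 j - v 0 j by rewrite !mxE.
rewrite -scalemxAr scaleE mulVKf ?gt_eqF// mulmxBr mulmx1 subE.
rewrite [(s l x)^T 0 j]mxE opprB.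
congr (_ - _); rewrite [LHS]mxE [RHS]mxE; apply: eq_bigr => k _.
by rewrite [col j _ k 0]mxE.
Qed.

(** A combination of the solutions [fun t => s t (x q)] is again a solution, so
    it vanishes near [lam] as soon as it vanishes at [lam]; the neighbourhood is
    the same for all points and coefficients. *)
Lemma smoother_relation (R : realType) (T : Type) n (s : R -> T -> 'cV[R]_n)
    (X : 'I_n -> T) (lam : R) :
  distillation_identity s X -> 0 < lam ->
  exists2 e, 0 < e < lam &
    forall m (x : 'I_m -> T) (c : 'I_m -> R),
      \sum_q c q *: s lam (x q) = 0 ->
      forall t, `|t - lam| <= e -> \sum_q c q *: s t (x q) = 0.
Proof.
move=> identity lam0.
pose B (t : R) : 'M[R]_n := t^-1 *: (smoother_mx s X t - 1%:M).
have cB k j : B t k j @[t --> lam] --> B lam k j.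
  rewrite /B; under eq_fun do rewrite !mxE; rewrite !mxE.
  apply: cvgM; first by apply: cvgV; [rewrite gt_eqF|exact: cvg_id].
  apply: cvgB; last exact: cvg_cst.
  apply: differentiable_continuous; rewrite -derivable1_diffP.
  by have [] := smoother_ode identity (X k) j lam0.
pose C := 1 + \sum_k \sum_j `|B lam k j|.
have C_gt0 : 0 < C.
  by rewrite ltr_pwDl// sumr_ge0// => k _; rewrite sumr_ge0.
have BC k j : `|B lam k j| < C.
  have Bk : `|B lam k j| <= \sum_j `|B lam k j|.
    by rewrite [leRHS](bigD1 j)//= lerDl sumr_ge0.
  apply: (le_lt_trans Bk); rewrite /C [X in 1 + X](bigD1 k)//= addrCA ltrDl.
  by rewrite ltr_pwDl// sumr_ge0// => k' _; rewrite sumr_ge0.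
have : \forall t \near lam, forall k j, `|B t k j| <= C.
  apply: (@filter_forall _ _ (fun k t => forall j, `|B t k j| <= C) _ (nbhs_filter lam)) => k.
  apply: (@filter_forall _ _ (fun j t => `|B t k j| <= C) _ (nbhs_filter lam)) => j.
  exact: (cvgr_norm_le _ (cB k j) _ (BC k j)).
move=> /nbhs_ballP[d /= d0 dB].
(* The three bounds keep [t] where the coefficients are at most [C], keep it
   positive, and ensure [e * C *+ n < 1]. *)
pose e := Num.min (d / 2) (Num.min (lam / 2) (C *+ n + 1)^-1).
have nC : 0 < C *+ n + 1 by rewrite ltr_wpDl// mulrn_wge0// ltW.
have e0 : 0 < e by rewrite !lt_min !divr_gt0// invr_gt0.
have e_lam : e < lam.
  by rewrite !gt_min; apply/orP; right; rewrite ltr_pdivrMr//; lra.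
exists e; first by rewrite e0.
move=> m x c c0 t te.
pose z j u := \sum_q c q * s u (x q) j 0.
have zE u : \sum_q c q *: s u (x q) = \col_j z j u.
  apply/colP => j; rewrite summxE mxE; apply: eq_bigr => q _; by rewrite mxE.
suff z0 j : z j t = 0 by rewrite zE; apply/colP => j; rewrite !mxE.
apply: (@linear_ode_unique R n z B lam e C) => //.
- move=> u ue i.
  have u0 : 0 < u by move: ue; rewrite ler_norml; lra.
  have -> : \sum_k z k u * B u k i =
      \sum_q c q * (\sum_k s u (x q) k 0 * B u k i).
    under [RHS]eq_bigr do rewrite mulr_sumr.
    rewrite exchange_big; apply: eq_bigr => k _; rewrite mulr_suml.
    by apply: eq_bigr => q _; rewrite mulrA.
  have -> : z i = \sum_q (c q *: (fun v => s v (x q) i 0)).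
    by apply/funext => v; rewrite fct_sumE.
  apply: is_derive_sum => q; apply: is_deriveZ.
  exact: smoother_ode.
- move=> u ue k i; apply: dB; rewrite /ball/= distrC.
  by apply: le_lt_trans ue _; rewrite gt_min ltr_pdivrMr//; apply/orP; left; lra.
- have : e <= (C *+ n + 1)^-1 by rewrite !ge_min lexx !orbT.
  rewrite -(@ler_pM2r _ (C *+ n + 1))// mulVf ?gt_eqF// mulrDr mulr1 mulrnAr.
  by lra.
- by move=> i; move: c0; rewrite zE => /colP/(_ i); rewrite !mxE.
Qed.

(** Any [n.+1] of the vectors [s lam (g q)] of [R^n] are dependent, and near
    [lam] the dependency persists; hence all [n.+1]-minors of the kernel
    [teacher s y] vanish there, and its skeleton decomposition exists. *)
Lemma teacher_skeleton (R : realType) (T : Type) n (s : R -> T -> 'cV[R]_n)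
    (X : 'I_n -> T) (y : 'cV[R]_n) (lam : R) :
  distillation_identity s X -> 0 < lam ->
  exists r (mu : 'I_r -> R) (x : 'I_r -> T) (A : 'M[R]_r),
    (forall q, 0 < mu q) /\
    (\forall t \near lam, forall z : T, teacher s y t z =
       \sum_q (\sum_p teacher s y t (x p) * A p q) * teacher s y (mu q) z).
Proof.
move=> identity lam0.
have [e /andP[e0 e_lam] rel] := smoother_relation identity lam0.
have [|r [mu [x [A [mu_e skel]]]]] := @skeleton_decomposition R R T
    (fun t => `|t - lam| <= e) (teacher s y) n.+1.
  move=> f g fe; apply/negP => u.
  pose W := \matrix_(q < n.+1, j < n) s lam (g q) j 0.
  have /rowV0Pn[v /sub_kermxP vW v0] : kermx W != 0.
    rewrite kermx_eq0 /row_free neq_ltn.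
    by rewrite (leq_ltn_trans (rank_leq_col W)).
  have v_rel : \sum_q v 0 q *: s lam (g q) = 0.
    transitivity (v *m W)^T; last by rewrite vW trmx0.
    apply/colP => j; rewrite summxE mxE [RHS]mxE.
    by apply: eq_bigr => q _; rewrite !mxE.
  set M := \matrix_(p, q) _ in u.
  have uT : M^T \in unitmx by rewrite unitmx_tr.
  have ME p q : M^T q p = teacher s y (f p) (g q) by rewrite !mxE.
  move/eqP: v0; apply; rewrite -(mulmxK uT v).
  suff -> : v *m M^T = 0 by rewrite mul0mx.
  apply/rowP => p; transitivity (((\sum_q v 0 q *: s (f p) (g q))^T *m y) 0 0).
    rewrite mxE linear_sum/= mulmx_suml summxE; apply: eq_bigr => q _.
    by rewrite ME linearZ/= -scalemxAl [RHS]mxE.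
  by rewrite (rel _ _ _ v_rel _ (fe p)) trmx0 mul0mx !mxE.
exists r, mu, x, A; split.
  by move=> q; have := mu_e q; rewrite ler_norml; lra.
apply/nbhs_ballP; exists e => //= t; rewrite /ball/= distrC => /ltW te z.
exact: skel.
Qed.

(** * The bilinear form of square-integrable functions *)

Section SquareIntegrable.
Context {d : measure_display} {Om : measurableType d} {R : realType}.
Variable P : probability Om R.
Implicit Types f g h : Om -> R.

Notation L2 := (Lfun P 2%:E).

Definition l2prod f g : R := \int[P]_w (f w * g w).

Lemma l2prodC f g : l2prod f g = l2prod g f.
Proof. by apply: eq_Rintegral => w _; rewrite mulrC. Qed.

Let integrableM f g : f \in L2 -> g \in L2 ->
  P.-integrable setT (EFin \o (fun w => f w * g w)).
Proof. by move=> f2 g2; apply/Lfun1_integrable; exact: Lfun2_mul_Lfun1. Qed.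

Lemma Lfun2B f g : f \in L2 -> g \in L2 -> f - g \in L2.
Proof. by move=> f2 g2; rewrite rpredB ?lee1n. Qed.

Lemma Lfun2Z a f : f \in L2 -> a *: f \in L2.
Proof. by move=> f2; rewrite rpredZ ?lee1n. Qed.

Lemma Lfun2_sum r (h : 'I_r -> Om -> R) : (forall q, h q \in L2) ->
  \sum_q h q \in L2.
Proof. by move=> h2; rewrite rpred_sum ?lee1n. Qed.

Lemma l2prodDl f g h : f \in L2 -> g \in L2 -> h \in L2 ->
  l2prod (f + g) h = l2prod f h + l2prod g h.
Proof.
move=> f2 g2 h2; rewrite -RintegralD//; try exact: integrableM.
by apply: eq_Rintegral => w _; rewrite -mulrDl.
Qed.

Lemma l2prodZl a f h : f \in L2 -> h \in L2 -> l2prod (a *: f) h = a * l2prod f h.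
Proof.
move=> f2 h2; rewrite -RintegralZl//; last exact: integrableM.
by apply: eq_Rintegral => w _; rewrite mulrA.
Qed.

Lemma l2prodBl f g h : f \in L2 -> g \in L2 -> h \in L2 ->
  l2prod (f - g) h = l2prod f h - l2prod g h.
Proof.
move=> f2 g2 h2; rewrite -scaleN1r l2prodDl ?l2prodZl ?mulN1r//; exact: Lfun2Z.
Qed.

Lemma l2prod_suml r (k : 'I_r -> Om -> R) h :
  (forall q, k q \in L2) -> h \in L2 ->
  l2prod (\sum_q k q) h = \sum_q l2prod (k q) h.
Proof.
move=> k2 h2.
elim: r k k2 => [|r IHr] k k2.
  rewrite !big_ord0 /l2prod; under eq_Rintegral do rewrite mul0r.
  by rewrite Rintegral_cst// mul0r.
rewrite !big_ord_recl l2prodDl ?IHr//; exact: Lfun2_sum.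
Qed.

Lemma sqnormB f g : f \in L2 -> g \in L2 ->
  l2prod (f - g) (f - g) = l2prod f f - 2 * l2prod f g + l2prod g g.
Proof.
move=> f2 g2; have fg2 := Lfun2B f2 g2.
rewrite l2prodBl// ![l2prod _ (f - g)]l2prodC !l2prodBl// (l2prodC g f); ring.
Qed.

(** A moving function that stays in the span of finitely many fixed
    square-integrable functions can be differentiated under the expectation:
    its squared distance to [f] is a polynomial in its coordinates. *)
Lemma is_derive_sqnorm r (h : 'I_r -> Om -> R) (c : 'I_r -> R -> R)
    (dc : 'I_r -> R) f (a : R) :
  f \in L2 -> (forall q, h q \in L2) ->
  (forall q, is_derive a 1 (c q) (dc q)) ->
  let e t := f - \sum_q c q t *: h q in
  is_derive a 1 (fun t => l2prod (e t) (e t)) (- 2 * l2prod (e a) (\sum_q dc q *: h q)).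
Proof.
move=> f2 h2 cdc e.
have ch2 (b : 'I_r -> R) : \sum_q b q *: h q \in L2.
  by apply: Lfun2_sum => q; exact: Lfun2Z.
have l2prod_comb (b : 'I_r -> R) g : g \in L2 ->
    l2prod (\sum_q b q *: h q) g = \sum_q b q * l2prod (h q) g.
  move=> g2; rewrite l2prod_suml//; last by move=> q; exact: Lfun2Z.
  by apply: eq_bigr => q _; rewrite l2prodZl.
have l2prod_comb2 (b b' : 'I_r -> R) :
    l2prod (\sum_q b q *: h q) (\sum_q b' q *: h q) =
    \sum_q \sum_p b q * b' p * l2prod (h q) (h p).
  rewrite l2prod_comb//; apply: eq_bigr => q _; rewrite l2prodC l2prod_comb// mulr_sumr.
  by apply: eq_bigr => p _; rewrite mulrA l2prodC.
have -> : (fun t => l2prod (e t) (e t)) = fun t => l2prod f f +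
    \sum_q (- 2 * l2prod (h q) f * c q t
            + \sum_p l2prod (h q) (h p) * (c q t * c p t)).
  apply/funext => t; rewrite sqnormB// -addrA; congr (_ + _).
  rewrite big_split/=; congr (_ + _).
    rewrite l2prodC l2prod_comb// mulr_sumr -sumrN.
    by apply: eq_bigr => q _; ring.
  rewrite l2prod_comb2; apply: eq_bigr => q _; apply: eq_bigr => p _.
  by rewrite mulrC.
have -> : - 2 * l2prod (e a) (\sum_q dc q *: h q) = 0 +
    \sum_q (- 2 * l2prod (h q) f * dc q
            + \sum_p l2prod (h q) (h p) * (c q a * dc p + c p a * dc q)).
  rewrite add0r big_split/= l2prodBl// mulrBr; congr (_ + _).
    rewrite l2prodC l2prod_comb// mulr_sumr.
    by apply: eq_bigr => q _; ring.
  have -> : \sum_q \sum_p l2prod (h q) (h p) * (c q a * dc p + c p a * dc q) =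
      \sum_q \sum_p c q a * dc p * l2prod (h q) (h p) +
      \sum_q \sum_p c q a * dc p * l2prod (h q) (h p).
    rewrite [X in _ = _ + X]exchange_big -big_split; apply: eq_bigr => q _.
    rewrite -big_split; apply: eq_bigr => p _ /=; rewrite (l2prodC (h p)); ring.
  by rewrite l2prod_comb2; ring.
have dlin q : is_derive a 1 (fun t => - 2 * l2prod (h q) f * c q t)
    (- 2 * l2prod (h q) f * dc q).
  exact: (is_deriveZ _ (cdc q)).
have dquad q : is_derive a 1
    (fun t => \sum_p l2prod (h q) (h p) * (c q t * c p t))
    (\sum_p l2prod (h q) (h p) * (c q a * dc p + c p a * dc q)).
  exact: (is_derive_sumE (fun p => is_deriveZ _ (is_deriveM (cdc q) (cdc p)))).
exact: (is_deriveD (is_derive_cst _ _ _)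
  (is_derive_sumE (fun q => is_deriveD (dlin q) (dquad q)))).
Qed.

End SquareIntegrable.

(** * Minimum of a quadratic polynomial *)

Lemma quadratic_argmin (R : realType) (g : R -> R) (a b c : R) :
  0 < a -> (forall t, g t = c + 2 * b * t + a * t ^+ 2) ->
  argmin g = [set - (b / a)] /\ g (- (b / a)) = c - b ^+ 2 / a.
Proof.
move=> a0 gE; have a_neq0 : a != 0 by rewrite gt_eqF.
have square t : g t = c - b ^+ 2 / a + a * (t + b / a) ^+ 2.
  by rewrite gE; field.
have min_val : g (- (b / a)) = c - b ^+ 2 / a.
  by rewrite square addNr expr0n/= mulr0 addr0.
split=> //; apply/seteqP; split=> [t /(_ (- (b / a)))|_ -> t].
  rewrite min_val square gerDl pmulr_rle0// => sq.
  by apply/eqP; rewrite -addr_eq0 -sqrf_eq0 eq_le sq sqr_ge0.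
by rewrite min_val square lerDl mulr_ge0 ?sqr_ge0// ltW.
Qed.

(** * Differentiating the risk, and conclusion *)

Section RiskDerivative.
Context {d : measure_display} {Om : measurableType d} {R : realType}.
Variable P : probability Om R.

Lemma riskE (T : Type) (x0 : Om -> T) (y0 : Om -> R) (f : T -> R) :
  risk P x0 y0 f = l2prod P (y0 - (f \o x0)) (y0 - (f \o x0)).
Proof. by rewrite /risk unlock; apply: eq_Rintegral => w _; rewrite expr2. Qed.

Lemma sq_discrepancyE (T : Type) (x0 : Om -> T) (f g : T -> R) :
  sq_discrepancy P x0 f g = l2prod P ((f \o x0) - (g \o x0)) ((f \o x0) - (g \o x0)).
Proof.
by rewrite /sq_discrepancy unlock; apply: eq_Rintegral => w _; rewrite expr2.
Qed.

(** The skeleton decomposition places the teachers near [lam] in the span of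
    finitely many teachers [h q], which are square integrable, with coordinates
    that are differentiable because they are combinations of values
    [teacher s y t (x p)] at fixed points. *)
Lemma is_derive_risk (T : Type) n (X : 'I_n -> T) (y : 'cV[R]_n)
    (s : R -> T -> 'cV[R]_n) (x0 : Om -> T) (y0 : Om -> R) (lam : R) :
  y0 \in Lfun P 2%:E ->
  (forall l, 0 < l -> teacher s y l \o x0 \in Lfun P 2%:E) ->
  distillation_identity s X -> 0 < lam ->
  is_derive lam 1 (fun l => risk P x0 y0 (teacher s y l))
    (- 2 * l2prod P (y0 - (teacher s y lam \o x0))
       (fun w => derive1 (fun l => teacher s y l (x0 w)) lam)).
Proof.
move=> y2 t2 identity lam0.
have [r [mu [x [A [mu0 skel]]]]] := teacher_skeleton y identity lam0.
pose h q := teacher s y (mu q) \o x0.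
pose c q t := \sum_p A p q * teacher s y t (x p).
pose dc q := \sum_p A p q * derive1 (fun l => teacher s y l (x p)) lam.
have dteacher z : is_derive lam 1 (fun l => teacher s y l z)
    (derive1 (fun l => teacher s y l z) lam).
  by rewrite derive1E; apply: DeriveDef => //; have [] := identity y z _ lam0.
have cdc q : is_derive lam 1 (c q) (dc q).
  exact: (is_derive_sumE (fun p => is_deriveZ _ (dteacher (x p)))).
have skel_h : \forall t \near lam, teacher s y t \o x0 = \sum_q c q t *: h q.
  apply: filterS skel => t skel_t; apply/funext => w /=; rewrite skel_t fct_sumE.
  apply: eq_bigr => q _; congr (_ * _).
  by apply: eq_bigr => p _; rewrite mulrC.
have dh : (fun w => derive1 (fun l => teacher s y l (x0 w)) lam) =
    \sum_q dc q *: h q.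
  apply/funext => w; rewrite fct_sumE derive1E.
  transitivity ('D_1 (fun t => \sum_q h q w * c q t) lam).
    apply: near_eq_derive; apply: filterS skel_h => t /(congr1 (@^~ w))/= ->.
    by rewrite fct_sumE; apply: eq_bigr => q _; exact: mulrC.
  have [_ ->] := is_derive_sumE (fun q => is_deriveZ (h q w) (cdc q)).
  by apply: eq_bigr => q _; exact: mulrC.
rewrite dh (nbhs_singleton skel_h).
apply: near_eq_is_derive (is_derive_sqnorm y2 _ cdc); last by move=> q; exact: t2.
by apply: filterS skel_h => t th; rewrite riskE th.
Qed.

End RiskDerivative.

Theorem theorem5p3
  (R : realType)
  (d dT : measure_display) (Om : measurableType d) (T : measurableType dT)
  (P : probability Om R)
  (n : nat) (X : 'I_n -> T) (y : 'cV[R]_n)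
  (s : R -> T -> 'cV[R]_n)
  (x0 : {RV P >-> T}) (y0 : {RV P >-> R})
  (y0_L2 : (y0 : Om -> R) \in Lfun P 2%:E)
  (teacher_L2 : forall l : R, 0 < l ->
     (fun w => teacher s y l (x0 w)) \in Lfun P 2%:E)
  (pd_L2 : forall l : R, 0 < l ->
     (fun w => pure_distilled s X y l (x0 w)) \in Lfun P 2%:E)
  (identity : distillation_identity s X)
  (risk_derivable : forall l : R, 0 < l ->
     derivable (fun l' : R => risk P x0 y0 (teacher s y l')) l 1)
  (lam : R) (lam_gt0 : 0 < lam)
  (D_gt0 :
     0 < sq_discrepancy P x0 (teacher s y lam) (pure_distilled s X y lam)) :
  let Rk := fun l : R => risk P x0 y0 (teacher s y l) in
  let D := sq_discrepancy P x0 (teacher s y lam) (pure_distilled s X y lam) in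
  let Rsd := fun xi : R => risk P x0 y0 (self_distilled s X y lam xi) in
  exists xi_star R_star : R,
    [/\ argmin Rsd = [set xi_star],
        R_star = Rsd xi_star,
        xi_star = - (lam / 2) * (derive1 Rk lam / D),
        R_star = Rk lam - lam ^+ 2 / 4 * (derive1 Rk lam ^+ 2 / D)
      & derive1 Rk lam != 0 ->
          R_star < Rk lam /\ Num.sg xi_star = - Num.sg (derive1 Rk lam)].
Proof.
move=> Rk D Rsd.
pose e := (y0 : Om -> R) - (teacher s y lam \o x0).
pose u := (teacher s y lam \o x0) - (pure_distilled s X y lam \o x0).
have t2 := teacher_L2 _ lam_gt0.
have e2 : e \in Lfun P 2%:E by apply: Lfun2B.
have u2 : u \in Lfun P 2%:E by apply: Lfun2B => //; exact: pd_L2.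
have DE : D = l2prod P u u by exact: sq_discrepancyE.
have dRk : l2prod P e u = lam / 2 * derive1 Rk lam.
  have [_] := is_derive_risk y0_L2 teacher_L2 identity lam_gt0.
  rewrite derive1E => ->.
  (* This is the distillation identity, solved for the derivative. *)
  have -> : (fun w => derive1 (fun l => teacher s y l (x0 w)) lam) =
      - lam^-1 *: u.
    apply/funext => w; rewrite /u -[RHS]/(_ * (_ - _)) /=.
    have [_ ->] := identity y (x0 w) _ lam_gt0.
    by rewrite mulrA mulrNN mulVf ?mul1r// gt_eqF.
  rewrite [l2prod P _ (_ *: _)]l2prodC l2prodZl// [l2prod P u _]l2prodC.
  by field; rewrite gt_eqF.
have RsdE xi : Rsd xi = Rk lam + 2 * l2prod P e u * xi + D * xi ^+ 2.
  have -> : Rsd xi = l2prod P (e - (- xi) *: u) (e - (- xi) *: u).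
    rewrite /Rsd riskE; suff -> : (y0 : Om -> R) - (self_distilled s X y lam xi \o x0) =
      e - (- xi) *: u by [].
    apply/funext => w; rewrite /e /u.
    rewrite -[LHS]/(_ - _) -[RHS]/((_ - _) - - xi * (_ - _)) /=.
    by rewrite self_distilledE; ring.
  rewrite sqnormB//; last exact: Lfun2Z.
  rewrite [l2prod P e (_ *: _)]l2prodC !l2prodZl//; last exact: Lfun2Z.
  rewrite [l2prod P u (_ *: _)]l2prodC l2prodZl// [l2prod P u e]l2prodC -DE /Rk riskE; ring.
have [argE minE] := quadratic_argmin D_gt0 RsdE.
have D_neq0 : D != 0 by rewrite gt_eqF.
exists (- (l2prod P e u / D)), (Rk lam - l2prod P e u ^+ 2 / D); split=> //.
- by rewrite dRk; field.
- by rewrite dRk; field.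
move=> dR_neq0; split.
  rewrite gtrBl divr_gt0// exprn_even_gt0//= dRk mulf_neq0//.
  by rewrite gt_eqF// divr_gt0.
have k0 : 0 < lam / 2 / D by rewrite !divr_gt0.
by rewrite dRk mulrAC sgrN sgrM (gtr0_sg k0) mul1r.
Qed.
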